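(* There is an absolute constant $M$ such that the following two statements hold. (1) For every positive integer $N$ there is a finite group $G$, nilpotent of class $4$, with $d_2(G)\geq 1/2^3$ and with a normal subgroup of order at most $M$ whose quotient is nilpotent of class at most $3$, such that every subgroup of $G$ that is nilpotent of class at most $3$ has index greater than $N$ in $G$. (2) There is an infinite group $G$, nilpotent of class $4$, with a normal subgroup of order at most $M$ whose quotient is nilpotent of class at most $3$, such that every commutator $[x,y]$ ($x,y\in G$) has at most $2^3$ conjugates in $G$ and $G$ has no finite-index subgroup that is nilpotent of class at most $3$.
   Context: Commutators are $[x,y]=x^{-1}y^{-1}xy$ and $[x,y,z]=[[x,y],z]$. For a finite group $G$, $d_2(G)=|\{(x,y,z)\in G^3:[x,y,z]=1\}|/|G|^3$. *)

(* Defs.v *)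
From HB Require Import structures.
From mathcomp Require Import all_boot all_order all_algebra all_fingroup all_solvable.
From mathcomp Require Import boolp classical_sets functions cardinality.

Set Implicit Arguments.
Unset Strict Implicit.
Unset Printing Implicit Defensive.

Import GroupScope.

Definition d2 (gT : finGroupType) (G : {group gT}) : rat :=
  (#|[pred t : gT * gT * gT |
       [&& t.1.1 \in G, t.1.2 \in G, t.2 \in G & [~ t.1.1, t.1.2, t.2]%g == 1%g]]|%:R
   / (#|G|%:R ^+ 3))%R.

(* The library's subgroup, quotient and nilpotency theory is restricted to
   finite groups. Below is its counterpart for an arbitrary groupType,
   subgroups being represented by classical sets. *)

Local Open Scope classical_set_scope.

Section Subgroups.
Variable G : groupType.
Implicit Types A B H : set G.

Definition is_subgroup H : Prop :=
  H 1 /\ forall x y, H x -> H y -> H (x * y^-1).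

Definition subgroup_gen A : set G := smallest is_subgroup A.

Definition commutator_subgroup A B : set G :=
  subgroup_gen [set [~ x, y] | x in A & y in B].

(* lower_central H n is the term of index n + 1 of the lower central series
   of H, so that lower_central H 0 = H. *)
Definition lower_central H (n : nat) : set G :=
  iter n (fun B => commutator_subgroup B H) H.

Definition nilpotent_of_class_le (c : nat) H : Prop :=
  lower_central H c = [set 1].

Definition nilpotent_of_class (c : nat) H : Prop :=
  nilpotent_of_class_le c H /\
  forall c' : nat, nilpotent_of_class_le c' H -> (c <= c')%N.

Definition finite_index H : Prop :=
  finite_set [set [set x * h | h in H] | x in [set: G]].

Definition conjugacy_orbit (x : G) : set G := [set x ^ g | g in [set: G]].

End Subgroups.

Record normal_subgroup (G : groupType) := NormalSubgroup {
  nsubg_set :> set G;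
  nsubg_group : is_subgroup nsubg_set;
  nsubg_normal : forall x g, nsubg_set x -> nsubg_set (x ^ g) }.

Section QuotientGroup.
Variables (G : groupType) (K : normal_subgroup G).
Implicit Types x y z : G.
Local Notation inK := (nsubg_set K).
Local Notation repr := generic_quotient.repr.

Let K1 : inK 1. Proof. by case: (nsubg_group K). Qed.

Let KV x : inK x -> inK x^-1.
Proof. by move=> Kx; rewrite -[_^-1]mul1g; apply: (nsubg_group K).2. Qed.

Let KM x y : inK x -> inK y -> inK (x * y).
Proof. by move=> Kx Ky; rewrite -[y]invgK; apply: (nsubg_group K).2 => //; apply: KV. Qed.

Definition coset_rel : rel G := fun x y => `[< inK (x^-1 * y) >].

Lemma coset_rel_refl : reflexive coset_rel.
Proof. by move=> x; apply/asboolP; rewrite mulVg. Qed.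

Lemma coset_rel_sym : symmetric coset_rel.
Proof.
by move=> x y; apply/asboolP/asboolP => /KV; rewrite invgM invgK.
Qed.

Lemma coset_rel_trans : transitive coset_rel.
Proof.
move=> y x z /asboolP xy /asboolP yz; apply/asboolP.
by have := KM xy yz; rewrite -mulgA mulKVg.
Qed.

Canonical coset_equiv :=
  EquivRel coset_rel coset_rel_refl coset_rel_sym coset_rel_trans.

Definition quot_group := {eq_quot coset_equiv}%qT.

HB.instance Definition _ := Choice.on quot_group.
HB.instance Definition _ := EqQuotient.on quot_group.

Local Notation pi := (\pi_quot_group)%qT.

Lemma quot_piE x y : pi x = pi y <-> inK (x^-1 * y).
Proof.
split=> [/eqP|Kxy]; first by rewrite eqmodE => /asboolP.
by apply/eqP; rewrite eqmodE; apply/asboolP.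
Qed.

Definition quot_one : quot_group := pi 1.
Definition quot_mul (u v : quot_group) : quot_group :=
  pi (repr u * repr v).
Definition quot_inv (u : quot_group) : quot_group :=
  pi (repr u)^-1.

Lemma quot_repr x : inK ((repr (pi x))^-1 * x).
Proof. by apply/quot_piE; rewrite reprK. Qed.

Lemma quot_piM x y : quot_mul (pi x) (pi y) = pi (x * y).
Proof.
apply/quot_piE; have := quot_repr y; have := quot_repr x.
set a := repr (pi x); set b := repr (pi y) => Kx Ky.
have -> : (a * b)^-1 * (x * y) = (a^-1 * x) ^ b * (b^-1 * y).
  by rewrite conjgE invgM !mulgA mulgK.
by apply: KM => //; apply: nsubg_normal.
Qed.

Lemma quot_piV x : quot_inv (pi x) = pi x^-1.
Proof.
apply/quot_piE; have := quot_repr x.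
set a := repr (pi x) => /KV Kx.
have -> : (a^-1)^-1 * x^-1 = ((a^-1 * x)^-1) ^ a^-1.
  by rewrite conjgE invgM !invgK !mulgA mulgK.
exact: nsubg_normal.
Qed.

Lemma quot_mulA : associative quot_mul.
Proof.
move=> u v w; rewrite -[u]reprK -[v]reprK -[w]reprK.
by rewrite (quot_piM (repr v)) (quot_piM (repr u) (repr v)) !quot_piM mulgA.
Qed.

Lemma quot_mul1 : left_id quot_one quot_mul.
Proof. by move=> u; rewrite -[u]reprK /quot_one quot_piM mul1g. Qed.

Lemma quot_1mul : right_id quot_one quot_mul.
Proof. by move=> u; rewrite -[u]reprK /quot_one quot_piM mulg1. Qed.

Lemma quot_mulV : left_inverse quot_one quot_inv quot_mul.
Proof. by move=> u; rewrite -[u]reprK quot_piV quot_piM mulVg. Qed.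

Lemma quot_Vmul : right_inverse quot_one quot_inv quot_mul.
Proof. by move=> u; rewrite -[u]reprK quot_piV quot_piM mulgV. Qed.

HB.instance Definition _ := isGroup.Build quot_group
  quot_mulA quot_mul1 quot_1mul quot_mulV quot_Vmul.

End QuotientGroup.

(* Main.v *)
Require Import Defs.
From mathcomp Require Import all_boot all_order all_algebra all_fingroup all_solvable.
From mathcomp Require Import boolp classical_sets functions cardinality.
From HB Require Import structures.
From mathcomp Require Import ring.

Set Implicit Arguments.
Unset Strict Implicit.
Unset Printing Implicit Defensive.

Import Order.TTheory GRing.Theory Num.Theory.
Local Open Scope ring_scope.

(** Let Y be an F_2-module with a symmetric bilinear form, R = F_2 + Y + F_2 eps
    the commutative ring in which y z = <y, z> eps, and W an R-module with a
    symmetric R-bilinear form. Let G be the group of matrices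
      1  a  c
      0  t  b
      0  0  1
    with t in 1 + Y + F_2 eps, a and b in W and c in F_2, where the product of a
    row a and a column b is the eps-coefficient of <a, b>. The matrices t
    commute, and (t' - 1) (t'' - 1) lies in F_2 eps, so that conjugating [x, y] by
    z moves its entries only by F_2 eps-multiples of those of x and y, with the
    two coefficients <x, z> and <y, z> (forms of the Y-parts) shared by the row
    and the column. With the corner entry this gives at most 2^3 conjugates.
    The central subgroup K of order 2 consisting of the corner entries contains
    the fourth term of the lower central series.
    For x a pure row, y and z pure diagonal matrices and w a pure column, the
    corner of [x, y, z, w] is the product of <y, z> and the constant part of
    <x, w>. By pigeonhole, a subgroup whose index is small compared with the
    rank of the forms (any finite index, in infinite rank) contains such
    elements with both factors nonzero, hence is not of class 3. *)

(** Regroups the difference of the entries of $xy$ and $yx$ into multiples by [unip t - 1], the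
    shape of the commutator formulas. *)
Lemma addB_swap (V : zmodType) (a b c d : V) : a + b - (c + d) = b - c - (d - a).
Proof. by rewrite opprD opprB [RHS]addrACA (addrC b). Qed.

(** * Modules with a symmetric bilinear form *)

Record formModule (R : comNzRingType) := FormModule {
  fm_sort :> lmodType R;
  form : fm_sort -> fm_sort -> R;
  formC : forall u v, form u v = form v u;
  formDl : forall u v w, form (u + v) w = form u w + form v w;
  formZl : forall a u v, form (a *: u) v = a * form u v }.

Section FormTheory.
Variables (R : comNzRingType) (V : formModule R).
Implicit Types u v w : V.

Lemma formDr u v w : form u (v + w) = form u v + form u w.
Proof. by rewrite formC formDl !(formC _ u). Qed.

Lemma formZr a u v : form u (a *: v) = a * form u v.
Proof. by rewrite formC formZl formC. Qed.

Lemma formNl u v : form (- u) v = - form u v.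
Proof. by rewrite -scaleN1r formZl mulN1r. Qed.

Lemma formNr u v : form u (- v) = - form u v.
Proof. by rewrite formC formNl formC. Qed.

Lemma form0l v : form 0 v = 0.
Proof. by rewrite -(scale0r 0) formZl mul0r. Qed.

Lemma form0r v : form v 0 = 0.
Proof. by rewrite formC form0l. Qed.

(* Of any two indices, both differences pair nontrivially: this property survives
   the pigeonhole argument. It holds for e_j the j-th basis vector and
   s_j = e_0 + ... + e_(j-1). *)
Definition ladder (n : nat) (e s : nat -> V) : Prop :=
  forall i j : nat, (i < n)%N -> (j < n)%N -> i != j ->
    form (e j - e i) (s j - s i) = -1.

End FormTheory.

(** * The ring F + Y + F eps and its unipotent units *)

Section FormRing.
Variables (F : comNzRingType) (Y : formModule F).

(* [(a, y, c)] stands for a + y + c eps in F + Y + F eps, where the product of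
   two elements y, z of Y is [form y z] eps, and eps kills Y and eps. *)
Definition form_ring : Type := (F * Y * F)%type.
HB.instance Definition _ := GRing.Zmodule.copy form_ring (F * Y * F)%type.

Definition fr_mul (r s : form_ring) : form_ring :=
  (r.1.1 * s.1.1, r.1.1 *: s.1.2 + s.1.1 *: r.1.2,
   r.1.1 * s.2 + s.1.1 * r.2 + form r.1.2 s.1.2).

Definition fr_one : form_ring := (1, 0, 0).

Lemma fr_mulA : associative fr_mul.
Proof.
move=> [[a y] c] [[a' y'] c'] [[a'' y''] c'']; rewrite /fr_mul /=.
congr (_, _, _); first exact: mulrA.
  by rewrite !scalerDr !scalerA addrA (mulrC a'' a) (mulrC a'' a').
rewrite formDl formDr !formZl !formZr !mulrDr !mulrA (mulrC a'' a) (mulrC a'' a').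
rewrite -!addrA; do 2![congr (_ + _)].
by rewrite addrCA; congr (_ + _); rewrite addrA addrC.
Qed.

Lemma fr_mulC : commutative fr_mul.
Proof.
move=> [[a y] c] [[a' y'] c']; rewrite /fr_mul /= formC mulrC.
by congr (_, _, _); [|congr (_ + _)]; exact: addrC.
Qed.

Lemma fr_mul1 : left_id fr_one fr_mul.
Proof.
move=> [[a y] c]; rewrite /fr_mul /= form0l !mul1r scale1r scaler0 mulr0.
by rewrite !addr0.
Qed.

Lemma fr_mulDl : left_distributive fr_mul +%R.
Proof.
move=> [[a y] c] [[a' y'] c'] [[a'' y''] c'']; rewrite /fr_mul /=.
congr (_, _, _) => /=; first exact: mulrDl.
  by rewrite scalerDl scalerDr addrACA.
by rewrite formDl mulrDl mulrDr [X in X + _ = _]addrACA [LHS]addrACA.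
Qed.

Lemma fr_one_neq0 : fr_one != 0.
Proof. by apply/eqP => -[] /eqP; rewrite oner_eq0. Qed.

HB.instance Definition _ := GRing.Zmodule_isComNzRing.Build form_ring
  fr_mulA fr_mulC fr_mul1 fr_mulDl fr_one_neq0.

Definition eps (u : F) : form_ring := (0, 0, u).
Definition unip (t : Y * F) : form_ring := (1, t.1, t.2).
Definition unip_mul (t t' : Y * F) : Y * F := (t.1 + t'.1, t.2 + t'.2 + form t.1 t'.1).
(** The expansion $(1+s)^{-1}=1-s+s^2$ with $s=y+c\,eps$: here $s^2=\langle y,y\rangle eps$ and
    $s^3=0$. *)
Definition unip_inv (t : Y * F) : Y * F := (- t.1, - t.2 + form t.1 t.1).

Lemma unip0 : unip 0 = 1.
Proof. by []. Qed.

Lemma unip_inv0 : unip_inv 0 = 0.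
Proof. by rewrite /unip_inv /= form0l oppr0 addr0 oppr0. Qed.

Lemma unipM t t' : unip t * unip t' = unip (unip_mul t t').
Proof.
rewrite /unip /unip_mul /GRing.mul /= /fr_mul /= !mul1r !scale1r.
by rewrite [t'.1 + _]addrC [t'.2 + _]addrC.
Qed.

Lemma unip_inj : injective unip.
Proof. by move=> [y c] [y' c'] [-> ->]. Qed.

Lemma unip_mulV t : unip_mul t (unip_inv t) = 0.
Proof.
by congr (_, _); rewrite /= ?subrr // formNr addrA subrr add0r subrr.
Qed.

Lemma unipV t : unip t * unip (unip_inv t) = 1.
Proof. by rewrite unipM unip_mulV. Qed.

Lemma unipB1M t t' : (unip t - 1) * (unip t' - 1) = eps (form t.1 t'.1).
Proof.
rewrite /unip /eps /GRing.mul /= /fr_mul /= subrr !scale0r !mul0r !addr0.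
by rewrite !subr0 add0r.
Qed.

Lemma unip_eps t u : unip t * eps u = eps u.
Proof.
rewrite /unip /eps /GRing.mul /= /fr_mul /= mulr0 mul0r scaler0 scale0r form0r mul1r.
by rewrite !addr0.
Qed.

Lemma epsM2 u r : (eps u * r).2 = r.1.1 * u.
Proof. by rewrite /= !mul0r form0l addr0 add0r. Qed.

End FormRing.

(** * The matrix group and its commutators *)

Section Group.
Variables (F : comNzRingType) (Y : formModule F) (W : formModule (form_ring Y)).

(* [(t, a, b, c)] is the matrix with rows (1, a, c), (0, unip t, b), (0, 0, 1),
   in which a product of a row a and a column b is the eps-coefficient of
   [form a b]. *)
Definition hgroup : Type := ((Y * F) * W * W * F)%type.
HB.instance Definition _ := Choice.copy hgroup ((Y * F) * W * W * F)%type.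

Definition tpart (x : hgroup) : Y * F := x.1.1.1.
Definition apart (x : hgroup) : W := x.1.1.2.
Definition bpart (x : hgroup) : W := x.1.2.
Definition cpart (x : hgroup) : F := x.2.

Definition hmul (x y : hgroup) : hgroup :=
  (unip_mul (tpart x) (tpart y),
   apart y + unip (tpart y) *: apart x,
   bpart x + unip (tpart x) *: bpart y,
   cpart x + cpart y + (form (apart x) (bpart y)).2).

Definition hone : hgroup := (0, 0, 0, 0).

Definition hinv (x : hgroup) : hgroup :=
  let r := unip (unip_inv (tpart x)) in
  (unip_inv (tpart x), - (r *: apart x), - (r *: bpart x),
   - cpart x + (form (apart x) (r *: bpart x)).2).

Lemma unip_mulC : commutative (@unip_mul F Y).
Proof. by move=> t t'; apply: unip_inj; rewrite -!unipM mulrC. Qed.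

Lemma hmulA : associative hmul.
Proof.
move=> [[[t a] b] c] [[[t' a'] b'] c'] [[[t'' a''] b''] c''].
rewrite /hmul /tpart /apart /bpart /cpart /=; congr (_, _, _, _).
- by apply: unip_inj; rewrite -!unipM mulrA.
- by rewrite scalerDr addrA scalerA -unipM mulrC.
- by rewrite scalerDr addrA scalerA -unipM.
(* Bilinearity over the whole ring lets [unip t'] pass from the row to the column, so the two
   corners agree. *)
rewrite formDl formDr formZl formZr /= !addrA.
ring.
Qed.

Lemma hmul1 : left_id hone hmul.
Proof.
move=> [[[t a] b] c]; rewrite /hmul /tpart /apart /bpart /cpart /=.
congr (_, _, _, _); last by rewrite form0l /= addr0 add0r.
- by apply: unip_inj; rewrite -unipM unip0 mul1r.
- by rewrite scaler0 addr0.
- by rewrite unip0 scale1r add0r.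
Qed.

Lemma hmulr1 : right_id hone hmul.
Proof.
move=> [[[t a] b] c]; rewrite /hmul /tpart /apart /bpart /cpart /=.
congr (_, _, _, _); last by rewrite form0r /= !addr0.
- by apply: unip_inj; rewrite -unipM unip0 mulr1.
- by rewrite unip0 scale1r add0r.
- by rewrite scaler0 addr0.
Qed.

Lemma hmulV : right_inverse hone hinv hmul.
Proof.
move=> [[[t a] b] c]; rewrite /hmul /hinv /tpart /apart /bpart /cpart /=.
congr (_, _, _, _).
- exact: unip_mulV.
- by rewrite addNr.
- by rewrite scalerN scalerA unipV scale1r subrr.
by rewrite addrA subrr add0r formNr formZr subrr.
Qed.

Lemma hmulVl : left_inverse hone hinv hmul.
Proof.
move=> [[[t a] b] c]; rewrite /hmul /hinv /tpart /apart /bpart /cpart /=.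
congr (_, _, _, _).
- by rewrite unip_mulC unip_mulV.
- by rewrite scalerN scalerA unipV scale1r subrr.
- by rewrite addNr.
by rewrite formNl formZl formZr /=; ring.
Qed.

HB.instance Definition _ := isGroup.Build hgroup hmulA hmul1 hmulr1 hmulVl hmulV.

Implicit Types x y z w k : hgroup.

Lemma hgroupP x y : tpart x = tpart y -> apart x = apart y -> bpart x = bpart y ->
  cpart x = cpart y -> x = y.
Proof.
case: x y => [[[t a] b] c] [[[t' a'] b'] c'].
by rewrite /tpart /apart /bpart /cpart /= => -> -> -> ->.
Qed.

Lemma tpartM x y : unip (tpart (x * y)%g) = unip (tpart x) * unip (tpart y).
Proof. by rewrite unipM. Qed.

Lemma apartM x y : apart (x * y)%g = apart y + unip (tpart y) *: apart x.
Proof. by []. Qed.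

Lemma bpartM x y : bpart (x * y)%g = bpart x + unip (tpart x) *: bpart y.
Proof. by []. Qed.

Lemma cpartM x y : cpart (x * y)%g = cpart x + cpart y + (form (apart x) (bpart y)).2.
Proof. by []. Qed.

Lemma unipK t (u v : W) : unip t *: u = v -> u = unip (unip_inv t) *: v.
Proof. by move=> <-; rewrite scalerA mulrC unipV scale1r. Qed.

Lemma unip_tpart_inj x (u v : W) :
  unip (tpart x) *: u = unip (tpart x) *: v -> u = v.
Proof. by move/unipK->; rewrite scalerA mulrC unipV scale1r. Qed.

Lemma tpartR x y : tpart [~ x, y]%g = 0.
Proof.
have := commgC x y; move: [~ x, y]%g => k /(congr1 (fun z => unip (tpart z))).
rewrite !tpartM => e; apply: unip_inj; rewrite unip0.
have V : unip (unip_inv (tpart y)) * unip (unip_inv (tpart x))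
    * (unip (tpart y) * unip (tpart x)) = 1.
  by rewrite mulrACA ![unip (unip_inv _) * _]mulrC !unipV mulr1.
by rewrite -[LHS]mul1r -{1}V -mulrA -e [unip (tpart x) * _]mulrC V.
Qed.

(** Compare the rows in $xy=yx[x,y]$, where $[x,y]$ has trivial diagonal. *)
Lemma apartR x y :
  apart [~ x, y]%g = (unip (tpart y) - 1) *: apart x - (unip (tpart x) - 1) *: apart y.
Proof.
have := commgC x y; move: [~ x, y]%g (tpartR x y) => k kT /(congr1 apart).
rewrite !apartM kT unip0 scale1r => /eqP; rewrite -subr_eq => /eqP <-.
by rewrite !scalerBl !scale1r addB_swap.
Qed.

(** In $yx[x,y]$ the column of the commutator is multiplied by the diagonal entry of $yx$. This unit
    is kept on the left-hand side and cancelled later by [unipK] or [unip_tpart_inj]. *)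
Lemma bpartR x y :
  unip (tpart y) * unip (tpart x) *: bpart [~ x, y]%g
  = (unip (tpart x) - 1) *: bpart y - (unip (tpart y) - 1) *: bpart x.
Proof.
have := commgC x y; move: [~ x, y]%g => k /(congr1 bpart).
rewrite !bpartM tpartM => /eqP; rewrite [X in _ == X]addrC -subr_eq => /eqP <-.
by rewrite !scalerBl !scale1r addB_swap.
Qed.

(** * A filtration containing the lower central series *)

Definition eps_image (w : W) : Prop := exists u : W, w = eps Y 1 *: u.
Definition thin (w : W) : Prop := forall t : Y * F, eps_image ((unip t - 1) *: w).

Lemma eps_imageB u v : eps_image u -> eps_image v -> eps_image (u - v).
Proof. by move=> [u' ->] [v' ->]; exists (u' - v'); rewrite scalerBr. Qed.

Lemma eps_imageZ r u : eps_image u -> eps_image (r *: u).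
Proof. by move=> [u' ->]; exists (r *: u'); rewrite !scalerA mulrC. Qed.

Lemma eps_image_eps u (v : W) : eps_image (eps Y u *: v).
Proof.
exists (((u, 0, 0) : form_ring Y) *: v); rewrite scalerA; congr (_ *: _).
by rewrite /eps [RHS]/GRing.mul /= /fr_mul /= !mul0r !scaler0 form0l mulr1 !addr0 add0r.
Qed.

Lemma unip_eps_image t u : eps_image u -> unip t *: u = u.
Proof. by move=> [u' ->]; rewrite scalerA unip_eps. Qed.

Lemma thinB u v : thin u -> thin v -> thin (u - v).
Proof. by move=> tu tv t; rewrite scalerBr; apply: eps_imageB. Qed.

Lemma thinZ r u : thin u -> thin (r *: u).
Proof. by move=> tu t; rewrite scalerA mulrC -scalerA; apply: eps_imageZ. Qed.

Lemma thin_unip t u : thin ((unip t - 1) *: u).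
Proof. by move=> t'; rewrite scalerA unipB1M; apply: eps_image_eps. Qed.

(* [hlevel i] contains the term of index i + 1 of the lower central series; [thin]
   stands in for having coordinates in Y + F eps. *)
Definition hlevel (i : nat) (x : hgroup) : Prop :=
  match i with
  | 0 => True
  | 1 => [/\ tpart x = 0, thin (apart x) & thin (bpart x)]
  | 2 => [/\ tpart x = 0, eps_image (apart x) & eps_image (bpart x)]
  | 3 => [/\ tpart x = 0, apart x = 0 & bpart x = 0]
  | _ => x = 1%g
  end.

(** Once the diagonal is trivial, rows and columns simply add under multiplication. *)
Lemma divg_parts x y : tpart x = 0 -> tpart y = 0 ->
  [/\ tpart (x * y^-1)%g = 0, apart (x * y^-1)%g = apart x - apart y
    & bpart (x * y^-1)%g = bpart x - bpart y].
Proof.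
case: x y => [[[t a] b] c] [[[t' a'] b'] c'].
rewrite [X in X = 0]/tpart [X in _ -> X = 0 -> _]/tpart /= => -> ->.
have -> : (((0, a, b, c) : hgroup) * ((0, a', b', c') : hgroup)^-1)%g =
  hmul (0, a, b, c) (hinv (0, a', b', c')) by [].
rewrite /hmul /hinv /tpart /apart /bpart /= unip_inv0 unip0 !scale1r.
by split=> //; [apply: unip_inj; rewrite -unipM unip0 mulr1 | rewrite addrC].
Qed.

Lemma hlevel_subgroup i : is_subgroup (hlevel i).
Proof.
have thin0 : thin 0 by move=> t; exists 0; rewrite !scaler0.
have eps0' : eps_image 0 by exists 0; rewrite scaler0.
case: i => [|[|[|[|i]]]]; split=> //=.
- move=> x y [xt xa xb] [yt ya yb]; have [-> -> ->] := divg_parts xt yt.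
  by split=> //; apply: thinB.
- move=> x y [xt xa xb] [yt ya yb]; have [-> -> ->] := divg_parts xt yt.
  by split=> //; apply: eps_imageB.
- move=> x y [xt xa xb] [yt ya yb]; have [-> -> ->] := divg_parts xt yt.
  by rewrite xa xb ya yb !subr0.
by move=> x y -> ->; rewrite mulgV.
Qed.

Lemma commg_tpart0 k z : tpart k = 0 ->
  apart [~ k, z]%g = (unip (tpart z) - 1) *: apart k /\
  unip (tpart z) *: bpart [~ k, z]%g = - ((unip (tpart z) - 1) *: bpart k).
Proof.
move=> kt; rewrite apartR; have := bpartR k z.
by rewrite kt unip0 mulr1 subrr !scale0r sub0r subr0.
Qed.

Lemma hlevel_central k z : hlevel 3 k -> [~ k, z]%g = 1%g.
Proof.
move=> [kt ka kb]; apply: (@mulgI _ (z * k)%g); rewrite -commgC mulg1.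
apply: hgroupP.
- by apply: unip_inj; rewrite !tpartM mulrC.
- by rewrite !apartM ka kt unip0 scaler0 scale1r addrC.
- by rewrite !bpartM kb kt unip0 scaler0 scale1r addrC.
by rewrite !cpartM ka kb form0l form0r /= !addr0 addrC.
Qed.

(** Up to units, each commutation applies some [unip t - 1] to row and column. The first makes them
    thin, the second moves them into eps W, the third kills them as eps W is fixed by all [unip t],
    and the remaining corner is central. *)
Lemma hlevel_commg i x y : hlevel i x -> hlevel i.+1 [~ x, y]%g.
Proof.
case: i => [_|[[xt xa xb]|[[xt xa xb]|[|i /= ->]]]] /=.
- rewrite tpartR; split=> //; first by rewrite apartR; apply: thinB; apply: thin_unip.
  have := bpartR x y; rewrite -scalerA => /unipK/unipK ->.
  by do 2!apply: thinZ; apply: thinB; apply: thin_unip.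
- have [ea eb] := commg_tpart0 y xt; rewrite tpartR ea; split=> //.
  by rewrite (unipK eb); apply: eps_imageZ; rewrite -scaleN1r; apply: eps_imageZ.
- have [ea eb] := commg_tpart0 y xt; rewrite tpartR ea (unipK eb).
  have fixE v : eps_image v -> (unip (tpart y) - 1) *: v = 0.
    by move=> ev; rewrite scalerBl unip_eps_image // scale1r subrr.
  by rewrite !fixE // oppr0 scaler0.
- exact: hlevel_central.
by rewrite comm1g.
Qed.

(** * Conjugates of a commutator *)

Definition orbit_param x y (p : F * F * F) : hgroup :=
  let k := [~ x, y]%g in
  (0, apart k + (eps Y p.1.1 *: apart x - eps Y p.1.2 *: apart y),
      bpart k + (eps Y p.1.1 *: bpart x - eps Y p.1.2 *: bpart y), p.2).

(** Write $[x,y]^z=[x,y]\,[[x,y],z]$. The last factor adds to row and column products of two factors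
    [unip t - 1], which [unipB1M] turns into eps times a form. *)
Lemma conjg_commg x y z :
  ([~ x, y] ^ z)%g = orbit_param x y
    (form (tpart z).1 (tpart y).1, form (tpart z).1 (tpart x).1, cpart ([~ x, y] ^ z)%g).
Proof.
have kt := tpartR x y; have bk := bpartR x y; have ak := apartR x y.
have -> : ([~ x, y] ^ z = [~ x, y] * [~ [~ x, y], z])%g by rewrite commgEl mulKVg.
rewrite /orbit_param; move: [~ x, y]%g kt bk ak => k kt bk ak.
have lt := tpartR k z; have [al bl] := commg_tpart0 z kt.
move: [~ k, z]%g lt al bl => l lt al bl.
apply: hgroupP => //=.
- by apply: unip_inj; rewrite tpartM kt lt !unip0 mulr1.
- rewrite apartM lt unip0 scale1r addrC al ak scalerBr !scalerA.
  by rewrite !unipB1M.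
rewrite bpartM kt unip0 scale1r; congr (_ + _).
set d := (X in _ = X).
have dE t : unip t *: d = d.
  by apply: unip_eps_image; apply: eps_imageB; apply: eps_image_eps.
(* The correction [d] lies in eps W and is unchanged by units, so both sides may be multiplied by
   the three diagonal entries, which brings [bl] and [bk] into play. *)
apply: (@unip_tpart_inj x); apply: (@unip_tpart_inj y); apply: (@unip_tpart_inj z).
rewrite !dE [_ *: (_ *: (_ *: bpart l))]scalerA mulrC -scalerA.
rewrite [unip (tpart z) *: (_ *: _)]scalerA mulrC -scalerA bl !scalerN !scalerA.
by rewrite mulrC -scalerA bk scalerBr !scalerA !unipB1M opprB.
Qed.

Lemma commg4_neq1 x y z w :
  tpart x = 0 -> bpart x = 0 -> tpart w = 0 -> apart w = 0 ->
  bpart y = 0 -> apart y = 0 -> bpart z = 0 -> apart z = 0 ->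
  form (tpart y).1 (tpart z).1 = -1 -> form (apart x) (bpart w) = -1 ->
  [~ x, y, z, w]%g <> 1%g.
Proof.
move=> xt xb wt wa yb ya zb za fyz fxw.
have kt := tpartR x y; have := bpartR x y; have := apartR x y.
rewrite yb xb ya xt unip0 mulr1 !scaler0 !subr0.
move: [~ x, y]%g kt => k kt ak; rewrite -[0](scaler0 _ (unip (tpart y))) => /unip_tpart_inj kb.
have lt := tpartR k z; have [] := commg_tpart0 z kt.
rewrite ak kb scaler0 oppr0; move: [~ k, z]%g lt => l lt al.
rewrite -[0](scaler0 _ (unip (tpart z))) => /unip_tpart_inj lb lw1.
(* If [l] and [w] commuted, comparing corners would give $\langle a_l,b_w\rangle$ zero
   eps-coefficient. But $a_l=\langle y,z\rangle eps\,a_x$, so that coefficient is $(-1)(-1)=1$. *)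
have := commgC l w; rewrite lw1 mulg1 => /(congr1 cpart).
rewrite !cpartM wa form0l addr0 [cpart w + _]addrC => /eqP; rewrite -subr_eq0 addrAC subrr add0r.
rewrite al scalerA unipB1M [form (tpart z).1 _]formC fyz formZl fxw epsM2 /= mulrNN mulr1.
by rewrite oner_eq0.
Qed.

Lemma ldivg_parts x y :
  [/\ (tpart (x^-1 * y)%g).1 = (tpart y).1 - (tpart x).1,
      apart (x^-1 * y)%g = apart y - unip (tpart y) *: (unip (unip_inv (tpart x)) *: apart x)
    & bpart (x^-1 * y)%g = unip (unip_inv (tpart x)) *: (bpart y - bpart x)].
Proof.
split; rewrite /= /tpart /apart /bpart /=.
- by rewrite addrC.
- by rewrite scalerN.
by rewrite scalerBr addrC.
Qed.

(** One pair of indices must serve all four families, so pigeonhole is applied to quadruples of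
    colours, whence $m^4$. The ladders then give both pairings the value $-1$. The colouring stands
    for left cosets of H and serves the finite and infinite cases alike. *)
Lemma ladder_commg4 n m (eY sY : nat -> Y) (eW sW : nat -> W)
    (col : hgroup -> 'I_m) (H : set hgroup) :
  ladder n eY sY -> ladder n eW sW -> (m ^ 4 < n)%N ->
  (forall x y, col x = col y -> H (x^-1 * y)%g) ->
  exists x y z w, [/\ H x, H y, H z, H w & [~ x, y, z, w]%g <> 1%g].
Proof.
move=> lY lW lt_mn colP.
pose x i : hgroup := (0, eW i, 0, 0); pose w i : hgroup := (0, 0, sW i, 0).
pose y i : hgroup := ((eY i, 0), 0, 0, 0); pose z i : hgroup := ((sY i, 0), 0, 0, 0).
pose f (i : 'I_n) := (col (x i), col (y i), col (z i), col (w i)).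
have /injectivePn[i [j neq_ij [ex ey ez ew]]] : ~~ injectiveb f.
  apply/negP => /injectiveP/leq_card; rewrite !card_prod !card_ord leqNgt.
  by rewrite (_ : (m * m * m * m = m ^ 4)%N) ?lt_mn // !expnS expn0 muln1 !mulnA.
exists ((x i)^-1 * x j)%g, ((y i)^-1 * y j)%g, ((z i)^-1 * z j)%g, ((w i)^-1 * w j)%g.
split; [exact: colP|exact: colP|exact: colP|exact: colP|].
have tE i' j' u v u' v' (c c' : F) : i' = 0 -> j' = 0 ->
    tpart (((i', u, v, c) : hgroup)^-1 * ((j', u', v', c') : hgroup))%g = 0.
  move=> -> ->; rewrite /tpart /= /tpart /= unip_inv0.
  by apply: unip_inj; rewrite -unipM unip0 mulr1.
have abE t t' u v u' v' (c c' : F) (k := ((t, u, v, c) : hgroup)^-1%g)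
    (l := (t', u', v', c') : hgroup) :
    (u = 0 -> u' = 0 -> apart (k * l)%g = 0) /\ (v = 0 -> v' = 0 -> bpart (k * l)%g = 0).
  have [_ -> ->] := ldivg_parts (t, u, v, c) l.
  by rewrite /apart /bpart /=; split=> -> ->; rewrite ?scaler0 subrr ?scaler0.
have [yt _ _] := ldivg_parts (y i) (y j); have [zt _ _] := ldivg_parts (z i) (z j).
have [_ xa _] := ldivg_parts (x i) (x j); have [_ _ wb] := ldivg_parts (w i) (w j).
apply: commg4_neq1; do ?[exact: tE|exact: (abE _ _ _ _ _ _ _ _).1|exact: (abE _ _ _ _ _ _ _ _).2].
  by rewrite yt zt; apply: lY.
by rewrite xa wb /tpart /= unip_inv0 unip0 !scale1r; apply: lW.
Qed.

End Group.

(** * Nilpotency and finite index in arbitrary groups *)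

Section Nilpotency.
Variable G : groupType.
Implicit Types (A B H : set G) (L : nat -> set G).
Local Open Scope classical_set_scope.

Lemma is_subgroup_gen A : is_subgroup (subgroup_gen A).
Proof.
split=> [M [[]] //|x y Ax Ay M [sM AM]].
by apply: sM.2; [apply: Ax|apply: Ay].
Qed.

Lemma lower_central1 H n : H 1%g -> lower_central H n 1%g.
Proof. by case: n => // n _; apply: (is_subgroup_gen _).1. Qed.

Lemma lower_central_commg H n x y :
  lower_central H n x -> H y -> lower_central H n.+1 [~ x, y]%g.
Proof. by move=> Hx Hy; apply: sub_gen_smallest; exists x => //; exists y. Qed.

(** By induction the generators of each term lie in the next subgroup of the chain. This is applied
    to the [hlevel] filtration and to its image in the quotient. *)
Lemma lower_central_sub H L n : H `<=` L 0 -> (forall i, is_subgroup (L i)) ->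
  (forall i x y, L i x -> H y -> L i.+1 [~ x, y]%g) -> lower_central H n `<=` L n.
Proof.
move=> HL sL cL; elim: n => // n IHn; apply: smallest_sub => // _ [x Hx [y Hy <-]].
by apply: cL => //; apply: IHn.
Qed.

Lemma nilpotent_of_class_leP H L n : is_subgroup H -> H `<=` L 0 ->
  (forall i, is_subgroup (L i)) ->
  (forall i x y, L i x -> H y -> L i.+1 [~ x, y]%g) -> L n `<=` [set 1%g] ->
  nilpotent_of_class_le n H.
Proof.
move=> [H1 _] HL sL cL L1; apply/seteqP; split=> [|_ ->].
  by apply: subset_trans L1; apply: lower_central_sub.
exact: lower_central1.
Qed.

Lemma nilpotent_of_class_leS H m n : H 1%g -> (m <= n)%N ->
  nilpotent_of_class_le m H -> nilpotent_of_class_le n H.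
Proof.
move=> H1 /subnK <- nilm; elim: (n - m)%N => // k; rewrite addSn => IHk.
apply/seteqP; split=> [|_ ->]; last exact: lower_central1.
apply: smallest_sub; first by split=> // _ _ -> ->; rewrite mulgV.
move=> _ [x Hx [y _ <-]]; have {Hx} : lower_central H (k + m) x := Hx.
by rewrite IHk => ->; rewrite /= comm1g.
Qed.

Lemma nilpotent3_commg4 H x y z w : H x -> H y -> H z -> H w ->
  nilpotent_of_class_le 3 H -> [~ x, y, z, w]%g = 1%g.
Proof.
move=> Hx Hy Hz Hw nilH; suff : lower_central H 3 [~ x, y, z, w]%g by rewrite nilH.
by do 3!apply: lower_central_commg => //.
Qed.

(** The colour of x is the position of the coset xH in a finite list of all left cosets. *)
Lemma finite_index_coloring H : is_subgroup H -> finite_index H ->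
  exists m (col : G -> 'I_m), forall x y, col x = col y -> H (x^-1 * y)%g.
Proof.
move=> [H1 _] /finite_seqP[s Es].
have in_s x : [set (x * h)%g | h in H] \in s.
  by move: (congr1 (fun B : set (set G) => B [set (x * h)%g | h in H]) Es) => /= <-; exists x.
exists (size s), (fun x => Ordinal (etrans (index_mem _ _) (in_s x))) => x y [].
move=> /(congr1 (nth set0 s)); rewrite !nth_index // => e.
have [] : [set (x * h)%g | h in H] y by rewrite e; exists 1%g; rewrite ?mulg1.
by move=> h Hh <-; rewrite mulKg.
Qed.

End Nilpotency.

(** Turns a parametrisation by a finite type into a cardinality bound, by enumerating T; the given
    element of T is the default of [nth]. *)
Lemma card_le_range (T : finType) (U : Type) (f : T -> U) (A : set U) : T ->
  (forall u, A u -> exists t, u = f t) -> (A #<= `I_#|T|)%card.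
Proof.
move=> t0 Af; apply: card_le_trans (card_image_le (f \o nth t0 (enum T)) `I_#|T|%classic).
apply: subset_card_le => u /Af[t ->]; exists (index t (enum T)) => /=.
  by rewrite cardE index_mem mem_enum.
by rewrite nth_index // mem_enum.
Qed.

(** * The dot product in finite rank *)

Section RowForm.
Variables (R : comNzRingType) (n : nat).

Definition row_dot (u v : 'rV[R]_n) : R := \sum_i u 0 i * v 0 i.

Fact row_dotC u v : row_dot u v = row_dot v u.
Proof. by apply: eq_bigr => i _; rewrite mulrC. Qed.

Fact row_dotDl u v w : row_dot (u + v) w = row_dot u w + row_dot v w.
Proof. by rewrite -big_split; apply: eq_bigr => i _; rewrite mxE mulrDl. Qed.

Fact row_dotZl a u v : row_dot (a *: u) v = a * row_dot u v.
Proof. by rewrite mulr_sumr; apply: eq_bigr => i _; rewrite mxE mulrA. Qed.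

Definition row_form : formModule R := FormModule row_dotC row_dotDl row_dotZl.

Lemma row_ladder :
  ladder (V := row_form) n (fun j => \row_k (k == j :> nat)%:R) (fun j => \row_k (k < j)%:R).
Proof.
have dotE j (v : 'rV[R]_n) (lt_jn : (j < n)%N) :
    row_dot (\row_k (k == j :> nat)%:R) v = v 0 (Ordinal lt_jn).
  rewrite /row_dot (bigD1 (Ordinal lt_jn)) //= mxE eqxx mul1r big1 ?addr0 // => i ne_ij.
  by rewrite mxE (negPf (ne_ij : i != j :> nat)) mul0r.
move=> i j lt_in lt_jn; rewrite formDl formNl /= !dotE !mxE /= !ltnn.
(* The value is $-[j<i]-[i<j]$ in truth values, hence $-1$ for either order of distinct indices. *)
by case: ltngtP => // _ _; rewrite !(subr0, sub0r, subrr, oppr0, add0r).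
Qed.

End RowForm.

(** * The dot product in countable rank *)

Section PolyForm.
Variable R : comNzRingType.
Implicit Types p q : {poly R}.

(** Polynomials serve as the free module of countable rank, with the monomials as orthonormal
    basis. *)
Definition poly_dot p q : R := \sum_(i < size p) p`_i * q`_i.

Lemma poly_dotE n p q : (size p <= n)%N -> poly_dot p q = \sum_(i < n) p`_i * q`_i.
Proof.
move=> le_pn; rewrite /poly_dot (big_ord_widen n (fun i => p`_i * q`_i) le_pn) big_mkcond.
by apply: eq_bigr => i _; case: ltnP => // ?; rewrite nth_default ?mul0r.
Qed.

Fact poly_dotC p q : poly_dot p q = poly_dot q p.
Proof.
rewrite (poly_dotE _ (leq_maxl (size p) (size q))) (poly_dotE _ (leq_maxr (size p) (size q))).
by apply: eq_bigr => i _; rewrite mulrC.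
Qed.

Fact poly_dotDl p q r : poly_dot (p + q) r = poly_dot p r + poly_dot q r.
Proof.
rewrite (poly_dotE _ (size_polyD p q)) (poly_dotE _ (leq_maxl (size p) (size q))).
rewrite (poly_dotE _ (leq_maxr (size p) (size q))) -big_split.
by apply: eq_bigr => i _; rewrite coefD mulrDl.
Qed.

Fact poly_dotZl a p q : poly_dot (a *: p) q = a * poly_dot p q.
Proof.
rewrite (poly_dotE _ (size_scale_leq a p)) mulr_sumr.
by apply: eq_bigr => i _; rewrite coefZ mulrA.
Qed.

Definition poly_form : formModule R := FormModule poly_dotC poly_dotDl poly_dotZl.

Lemma poly_ladder n : ladder (V := poly_form) n (fun j => 'X^j) (fun j => \poly_(k < j) 1).
Proof.
have dotE j q : poly_dot 'X^j q = q`_j.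
  rewrite /poly_dot size_polyXn big_ord_recr big1 /= ?coefXn ?eqxx ?mul1r ?add0r // => i _.
  by rewrite coefXn ltn_eqF ?mul0r.
move=> i j _ _; rewrite formDl formNl /= !dotE !coefB !coef_poly !ltnn.
by case: ltngtP => // _ _; rewrite !(subr0, sub0r, subrr, oppr0, add0r).
Qed.

End PolyForm.

(** * The corner subgroup and the class bounds *)

Section Kernel.
Variables (F : comNzRingType) (Y : formModule F) (W : formModule (form_ring Y)).
Local Notation G := (hgroup W).

Fact hlevel3_conjg (k z : G) : hlevel 3 k -> hlevel 3 (k ^ z)%g.
Proof. by move=> k3; rewrite -[(k ^ z)%g](mulKVg k) -commgEl hlevel_central // mulg1. Qed.

Definition hkernel : normal_subgroup G :=
  NormalSubgroup (hlevel_subgroup W 3) hlevel3_conjg.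

Lemma hgroup_nilpotent : nilpotent_of_class_le 4 [set: G]%classic.
Proof.
apply: (@nilpotent_of_class_leP _ _ (@hlevel _ _ W)) => //.
- exact: hlevel_subgroup.
- by move=> i x y xi _; apply: hlevel_commg.
Qed.

(** The images of the [hlevel] terms filter the quotient, and the image of [hlevel 3], the kernel
    itself, is trivial. *)
Lemma hgroup_quot_nilpotent : nilpotent_of_class_le 3 [set: quot_group hkernel]%classic.
Proof.
pose pi : G -> quot_group hkernel := \pi_(quot_group hkernel)%qT.
have piM x y : pi (x * y)%g = (pi x * pi y)%g by apply/esym; apply: (@quot_piM _ hkernel).
have piV x : pi x^-1%g = (pi x)^-1%g by apply/esym; apply: (@quot_piV _ hkernel).
have pi_surj u : exists x, u = pi x by exists (generic_quotient.repr u); rewrite /pi reprK.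
apply: (@nilpotent_of_class_leP _ _ (fun i => [set pi x | x in @hlevel _ _ W i])%classic) => //.
- by move=> u _; have [x ->] := pi_surj u; exists x.
- move=> i; have [h1 hV] := hlevel_subgroup W i; split; first by exists 1%g.
  by move=> _ _ [x xi <-] [y yi <-]; exists (x * y^-1)%g; rewrite ?piM ?piV //; apply: hV.
- move=> i _ v [x xi <-] _; have [y ->] := pi_surj v; exists [~ x, y]%g.
    exact: hlevel_commg.
  by rewrite /commg /conjg !piM !piV.
by move=> _ [x x3 <-]; apply/quot_piE => /=; rewrite mulg1; have [h1 hV] := hlevel_subgroup W 3;
  rewrite -[_^-1%g]mul1g; apply: hV.
Qed.

End Kernel.

Lemma hlevel3_card (F : finComNzRingType) (Y : formModule F) (W : formModule (form_ring Y)) :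
  (hlevel (W := W) 3 #<= `I_#|F|)%card.
Proof.
apply: (card_le_range (f := fun c : F => (0, 0, 0, c) : hgroup W) (0 : F)) => x [xt xa xb].
by exists (cpart x); apply: hgroupP.
Qed.

Lemma conjugacy_orbit_card (F : finComNzRingType) (Y : formModule F)
    (W : formModule (form_ring Y)) (x y : hgroup W) :
  (conjugacy_orbit [~ x, y]%g #<= `I_(#|F| ^ 3)%N)%card.
Proof.
have <- : (#|{: F * F * F}| = #|F| ^ 3)%N by rewrite !card_prod !expnS expn0 muln1 mulnA.
apply: (card_le_range (f := orbit_param x y) (0 : F * F * F)) => _ [z _ <-].
by rewrite conjg_commg; eexists.
Qed.

(** * The infinite example *)

Lemma poly_hgroup_no_class3 (F : comNzRingType) :
  let G := hgroup (poly_form (form_ring (poly_form F))) in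
  ~ exists H : set G, [/\ is_subgroup H, finite_index H & nilpotent_of_class_le 3 H].
Proof.
move=> G [H [sH fH nilH]]; have [m [col colP]] := finite_index_coloring sH fH.
(* In countable rank there are ladders of every length; $m^4+1$ suffices against m colours. *)
have [x [y [z [w [Hx Hy Hz Hw]]]]] :=
  ladder_commg4 (@poly_ladder _ _) (@poly_ladder _ _) (ltnSn (m ^ 4)) colP.
by case; apply: nilpotent3_commg4 nilH.
Qed.

Lemma infinite_hgroup :
  exists G : groupType,
    [/\ infinite_set [set: G]%classic,
        nilpotent_of_class 4 [set: G]%classic,
        (exists K : normal_subgroup G,
           (nsubg_set K #<= `I_2%N)%card /\
           nilpotent_of_class_le 3 [set: quot_group K]%classic),
        (forall x y : G, (conjugacy_orbit [~ x, y]%g #<= `I_(2 ^ 3)%N)%card)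
      & ~ exists H : set G,
            [/\ is_subgroup H, finite_index H & nilpotent_of_class_le 3 H]].
Proof.
pose G := hgroup (poly_form (form_ring (poly_form 'F_2))).
have noH := @poly_hgroup_no_class3 'F_2; rewrite /= -/G in noH.
have cF : #|'F_2| = 2%N by rewrite card_Fp.
exists G; split.
(* In a finite group the trivial subgroup would have finite index, against [noH]. *)
- move=> finG; apply: noH; exists [set 1%g]%classic; split.
  + by split=> // _ _ -> ->; rewrite mulgV.
  + exact: finite_image.
  apply: (@nilpotent_of_class_leP _ _ (fun=> [set 1%g])%classic) => //.
  + by split=> // _ _ -> ->; rewrite mulgV.
  + by move=> _; split=> // _ _ -> ->; rewrite mulgV.
  by move=> _ _ _ -> ->; rewrite /= comm1g.
- split; first exact: hgroup_nilpotent.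
  (* Class below 4 would make the whole group, of index 1, contradict [noH]. *)
  move=> c nilc; rewrite leqNgt; apply/negP => lt_c4; apply: noH.
  exists [set: G]%classic; split => //; last exact: nilpotent_of_class_leS nilc.
  by apply: sub_finite_set (finite_set1 [set: G]%classic) => _ [x _ <-] /=;
    apply/seteqP; split=> // y _; exists (x^-1 * y)%g; rewrite ?mulKVg.
- exists (hkernel _); split; last exact: hgroup_quot_nilpotent.
  by have := @hlevel3_card 'F_2 _ (poly_form (form_ring (poly_form 'F_2))); rewrite cF.
- by move=> x y; have := conjugacy_orbit_card x y; rewrite cF.
exact: noH.
Qed.

(** * The finite groups *)

Section FiniteGroup.
Variables (F : finComNzRingType) (n : nat).

Definition row_ring : Type := form_ring (row_form F n).
HB.instance Definition _ := GRing.ComNzRing.on row_ring.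
HB.instance Definition _ := Finite.copy row_ring (F * 'rV[F]_n * F)%type.

Definition row_hgroup : Type := hgroup (row_form row_ring n).
HB.instance Definition _ := Group.on row_hgroup.
HB.instance Definition _ :=
  Finite.copy row_hgroup (('rV[F]_n * F) * 'rV[row_ring]_n * 'rV[row_ring]_n * F)%type.

Local Notation T := (row_hgroup : finGroupType).
Local Notation W := (row_form row_ring n).
Implicit Types x y z : T.

Definition hlevel_set (i : nat) : {set T} := [set x | `[< hlevel (W := W) i x >]].

Lemma in_hlevel_set i x : reflect (hlevel (W := W) i x) (x \in hlevel_set i).
Proof. by rewrite inE; apply: asboolP. Qed.

Lemma hlevel_set_group_set i : group_set (hlevel_set i).
Proof.
have [h1 hV] := hlevel_subgroup W i.
apply/group_setP; split=> [|x y /in_hlevel_set xi /in_hlevel_set yi]; apply/in_hlevel_set => //.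
rewrite -[y]invgK; apply: (hV) => //; rewrite -[(y^-1)%g]mul1g; exact: hV.
Qed.
Canonical hlevel_group i := Group (hlevel_set_group_set i).

(** The shift arises because ['L_1] is the group itself while the filtration starts at
    [hlevel 0]. *)
Lemma lcn_hlevel i : 'L_i.+1([set: T])%g \subset hlevel_set i.
Proof.
elim: i => [|i IHi]; first by apply/fintype.subsetP => x _; apply/in_hlevel_set.
rewrite lcnSn gen_subG; apply/fintype.subsetP => _ /imset2P[x y xi _ ->].
move: (fintype.subsetP IHi x xi) => /in_hlevel_set xi'.
by apply/in_hlevel_set; apply: (hlevel_commg (W := W)).
Qed.

Lemma lcn5_row_hgroup : 'L_5([set: T])%g = 1%g.
Proof.
apply/trivgP/(fintype.subset_trans (lcn_hlevel 4)).
by apply/fintype.subsetP => x /in_hlevel_set /= ->; apply: group1.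
Qed.

Lemma row_hgroup_nil : nilpotent [set: T]%g.
Proof. by apply/lcnP; exists 4%N; apply: lcn5_row_hgroup. Qed.

(** Colour by left cosets of H. If the fourth power of the index were below n, pigeonhole would give
    a nontrivial fourfold commutator in ['L_4(H)], which is trivial. *)
Lemma row_hgroup_index (H : {group T}) :
  nilpotent H -> (nil_class H <= 3)%N -> (n <= #|[set: T] : H|%g ^ 4)%N.
Proof.
move=> nilH /(lcn_nil_classP _ nilH) L4; rewrite leqNgt; apply/negP.
rewrite -card_lcosets.
have in_lc x : (x *: H)%g \in lcosets H [set: T].
  by apply/lcosetsP; exists x.
pose col x : 'I_#|lcosets H [set: T]| := enum_rank_in (in_lc x) (x *: H)%g.
have colP x y : col x = col y -> (x^-1 * y)%g \in H.
  move=> /(congr1 enum_val); rewrite !enum_rankK_in // => e.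
  by rewrite -mem_lcoset e lcoset_refl.
move=> lt_n.
have [x [y [z [w [Hx Hy Hz Hw]]]]] := ladder_commg4 (W := W) (H := [set x | x \in H]%classic)
  (@row_ladder F n) (@row_ladder row_ring n) lt_n colP.
case; have : [~ x : T, y, z, w]%g \in 'L_4(H)%g by do 3!apply: mem_commg => //.
by rewrite L4 => /set1gP.
Qed.

Lemma row_hgroup_class : (1 < n)%N -> nil_class [set: T]%g = 4%N.
Proof.
move=> n_gt1; apply/eqP; rewrite eqn_leq; apply/andP; split.
  by apply/(lcn_nil_classP _ row_hgroup_nil); apply: lcn5_row_hgroup.
(* Were the class at most 3, the index bound for the whole group would force $n\le 1$. *)
rewrite ltnNge; apply/negP => /(row_hgroup_index row_hgroup_nil).
by rewrite indexgg leqNgt n_gt1.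
Qed.

Lemma hlevel3_normal : (hlevel_group 3 <| [set: T])%g.
Proof.
rewrite /normal finset.subsetT; apply/fintype.subsetP => z _; rewrite inE.
apply/fintype.subsetP => _ /imsetP[k k3 ->].
by apply/in_hlevel_set/(hlevel3_conjg (W := W))/in_hlevel_set.
Qed.

Lemma card_hlevel3 : (#|hlevel_group 3| <= #|F|)%N.
Proof.
rewrite -[leqRHS]cardsT.
apply: (leq_trans _ (leq_imset_card (fun c : F => (0, 0, 0, c) : T) [set: F]%SET)).
apply/subset_leq_card/fintype.subsetP => x /in_hlevel_set[xt xa xb].
by apply/imsetP; exists (cpart (W := W) x); rewrite ?inE //; apply: (@hgroupP _ _ W).
Qed.

Lemma row_hgroup_quot_nil_class : (nil_class ([set: T] / hlevel_group 3)%g <= 3)%N.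
Proof.
apply/(lcn_nil_classP _ (quotient_nil _ row_hgroup_nil)).
rewrite /quotient -morphim_lcn; last by case/andP: hlevel3_normal.
by apply: quotientS1; apply: lcn_hlevel.
Qed.

Lemma row_hgroup_card_class x y : (#|([~ x, y] ^: [set: T])%g| <= #|F| ^ 3)%N.
Proof.
have <- : (#|[set: F * F * F]%SET| = #|F| ^ 3)%N.
  by rewrite cardsT !card_prod !expnS expn0 muln1 mulnA.
apply: (leq_trans _ (leq_imset_card (orbit_param (W := W) x y : _ -> T) [set: F * F * F]%SET)).
apply/subset_leq_card/fintype.subsetP => _ /imsetP[z _ ->].
by apply/imsetP; eexists; last exact: (conjg_commg (W := W)).
Qed.

End FiniteGroup.

(** * The bound on d_2 and the finite examples *)

Lemma d2_ge (gT : finGroupType) (m : nat) : (0 < m)%N ->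
  (forall x y : gT, (#|([~ x, y] ^: [set: gT])%g| <= m)%N) -> 1 / m%:R <= d2 [set: gT].
Proof.
move=> m_gt0 le_m; rewrite /d2.
have G_gt0 : (0 < #|[set: gT]|)%N by rewrite cardG_gt0.
rewrite ler_pdivlMr ?exprn_gt0 ?ltr0n // mulrAC mul1r ler_pdivrMr ?ltr0n //.
rewrite -natrX -natrM ler_nat cardsT.
(* Triples are counted over pairs (x, y): the admissible z form the centraliser of $[x,y]$, whose
   order is $|G|$ over the size of the conjugacy class. *)
pose C (p : gT * gT) : {set gT} := 'C[[~ p.1, p.2]]%g.
have -> : #|[pred t : gT * gT * gT | [&& t.1.1 \in [set: gT], t.1.2 \in [set: gT],
    t.2 \in [set: gT] & [~ t.1.1, t.1.2, t.2]%g == 1%g]]| = (\sum_p #|C p|)%N.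
  under [RHS]eq_bigr do rewrite -sum1_card.
  rewrite -sum1_card pair_big_dep; apply: eq_bigl => -[p z] /=.
  rewrite [LHS]inE /= !finset.in_setT /C /=.
  by apply/commgP/cent1P => /commute_sym.
have CE p : (#|[set: gT]| <= #|C p| * m)%N.
  rewrite -(LagrangeI [set: gT] 'C[[~ p.1, p.2]]) -indexgI index_cent1 finset.setTI leq_mul2l le_m.
  by rewrite orbT.
rewrite -[#|gT|]cardsT !expnS expn0 muln1 big_distrl /=.
apply: leq_trans (leq_sum _ (fun p _ => CE p)).
by rewrite sum_nat_const card_prod -[#|gT|]cardsT mulnA.
Qed.

Lemma finite_hgroup (N : nat) : (0 < N)%N ->
  exists (gT : finGroupType) (G : {group gT}),
    [/\ nilpotent G /\ nil_class G = 4%N,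
        1 / 2%:R ^+ 3 <= d2 G,
        (exists K : {group gT},
           [/\ (K <| G)%g, (#|K| <= 2)%N, nilpotent (G / K)%g & (nil_class (G / K)%g <= 3)%N])
      & forall H : {group gT}, H \subset G ->
          nilpotent H -> (nil_class H <= 3)%N -> (N < #|G : H|%g)%N].
Proof.
(* With this rank, the bound of n by the fourth power of the index says exactly that the index
   exceeds N. *)
move=> N_gt0; pose n := (N ^ 4).+1.
have cF : #|'F_2| = 2%N by rewrite card_Fp.
exists (row_hgroup 'F_2 n : finGroupType), [group of [set: row_hgroup 'F_2 n]]; split.
- by split; [exact: row_hgroup_nil|apply: row_hgroup_class; rewrite ltnS expn_gt0 N_gt0].
- rewrite -natrX; apply: d2_ge => // x y.
  by have := row_hgroup_card_class x y; rewrite cF.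
- exists (hlevel_group 'F_2 n 3); split; first exact: hlevel3_normal.
  + by have := card_hlevel3 'F_2 n; rewrite cF.
  + exact: quotient_nil (row_hgroup_nil _ _).
  + exact: row_hgroup_quot_nil_class.
move=> H _ nilH clH; have := row_hgroup_index nilH clH.
by rewrite ltn_exp2r.
Qed.

Local Close Scope ring_scope.

Theorem mainTheorem3 :
  exists M : nat,
    (forall N : nat, 0 < N ->
       exists (gT : finGroupType) (G : {group gT}),
         [/\ nilpotent G /\ nil_class G = 4,
             (1 / 2%:R ^+ 3 <= d2 G)%R,
             (exists K : {group gT},
                [/\ (K <| G)%g, #|K| <= M,
                    nilpotent (G / K)%g & nil_class (G / K)%g <= 3])
           & forall H : {group gT}, H \subset G ->
               nilpotent H -> nil_class H <= 3 -> N < #|G : H|%g])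
    /\
    (exists G : groupType,
       [/\ infinite_set [set: G]%classic,
           nilpotent_of_class 4 [set: G]%classic,
           (exists K : normal_subgroup G,
              (nsubg_set K #<= `I_M)%card /\
              nilpotent_of_class_le 3 [set: quot_group K]%classic),
           (forall x y : G, (conjugacy_orbit [~ x, y]%g #<= `I_(2 ^ 3))%card)
         & ~ exists H : set G,
               [/\ is_subgroup H, finite_index H & nilpotent_of_class_le 3 H]]).
Proof.
(* The constant is the order of the field ['F_2], in which the corner entries lie. *)
exists 2; split=> [N|]; first exact: finite_hgroup.
exact: infinite_hgroup.
Qed.
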